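(* Let $n,p\in\mathbb{N}$, let $\delta$ be a positive infinitesimal in ${}^*\mathbb{R}$ and let $\tau=\tau^\delta$. Suppose that $[h]\in\mathcal{G}^0_{p,p}$. Then $lc_{[h]}:\mathcal{G}^0_{n,p}\to\mathcal{G}^0_{n,p}$, $[f]\mapsto[h\circ f]$, is a continuous map.
   Context: A sufficiently saturated nonstandard extension $X\mapsto{}^*X$ (at least an enlargement) is fixed. For $n,p\in\mathbb{N}$, $\mathcal{G}_{n,p}$ is the set of germs at $0$ of maps $f:(\mathbb{R}^n,0)\to(\mathbb{R}^p,0)$ (defined on a neighborhood of $0$, $f(0)=0$) and $\mathcal{G}^0_{n,p}$ the subset of germs of maps continuous on a neighborhood of $0$. Topology on $\mathcal{G}_{n,1}$: for real $r>0$, $\|f\|_r=\sup\{|f(x)|:|x|\le r\}$, and ${}^*\|f\|_\delta$ is the value at $\delta$ of the transfer of $r\mapsto\|f\|_r$. $\mathcal{M}$ is the set of germs at $0$ of functions $m:\mathbb{R}_+\to\mathbb{R}_+$ with $\lim_{t\to0}m(t)=0$ and $m(r)<m(t)$ for all sufficiently small $0<r<t$. $\mathcal{N}_\delta=\{{}^*m(\delta):[m]\in\mathcal{M}\}$. For $\mathfrak r\in\mathcal{N}_\delta$, $U^\delta_{\mathfrak r}=\{[f]\in\mathcal{G}_{n,1}:{}^*\|f\|_\delta<\mathfrak r\}$. $\tau^\delta$ is the topology on $\mathcal{G}_{n,1}$ generated by the subbase of all translates $U^\delta_{\mathfrak r}+[f]$, $\mathfrak r\in\mathcal{N}_\delta$,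 $[f]\in\mathcal{G}_{n,1}$. $\mathcal{G}_{n,p}$, as the product of $p$ copies of $\mathcal{G}_{n,1}$, carries the product topology (also denoted $\tau$), and $\mathcal{G}^0_{n,p}$ the subspace topology. *)

(* Defs.v *)
From HB Require Import structures.
From mathcomp Require Import all_boot all_order all_algebra.
From mathcomp Require Import generic_quotient.
From mathcomp Require Import all_classical all_reals all_analysis.

Set Implicit Arguments.
Unset Strict Implicit.
Unset Printing Implicit Defensive.

Import Order.TTheory GRing.Theory Num.Theory.
Import numFieldNormedType.Exports.

Local Open Scope classical_set_scope.
Local Open Scope ring_scope.
Local Open Scope quotient_scope.

(* Nonstandard extension X |-> *X of the universe of types, in the axiomatic
   form of Henson (the operation A |-> *A on sets and relations commutes with
   the Boolean operations, products, the diagonal, inverse images and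
   projections).  By induction on formulas, these axioms amount to the transfer
   principle for all first-order formulas over arbitrary sets, functions and
   relations; internal sets are the elements of *(set T). *)
Record nonstandard_extension := NonstandardExtension {
  star :> Type -> Type ;
  emb : forall T : Type, T -> star T ;
  starf : forall S T : Type, (S -> T) -> star S -> star T ;
  starset : forall T : Type, set T -> set (star T) ;
  starpair : forall S T : Type, star S -> star T -> star (S * T) ;
  starf_id : forall (T : Type) (x : star T), starf id x = x ;
  starf_comp : forall (S T U : Type) (g : T -> U) (f : S -> T) (x : star S),
    starf (g \o f) x = starf g (starf f x) ;
  starf_emb : forall (S T : Type) (f : S -> T) (x : S),
    starf f (emb x) = emb (f x) ;
  starpair_fst : forall (S T : Type) (x : star S) (y : star T),
    starf fst (starpair x y) = x ;
  starpair_snd : forall (S T : Type) (x : star S) (y : star T),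
    starf snd (starpair x y) = y ;
  starpair_eta : forall (S T : Type) (z : star (S * T)),
    starpair (starf fst z) (starf snd z) = z ;
  starsetC : forall (T : Type) (A : set T), starset (~` A) = ~` starset A ;
  starsetI : forall (T : Type) (A B : set T),
    starset (A `&` B) = starset A `&` starset B ;
  starset_preimage : forall (S T : Type) (f : S -> T) (B : set T),
    starset (f @^-1` B) = starf f @^-1` starset B ;
  starset_image : forall (S T : Type) (f : S -> T) (A : set S),
    starset (f @` A) = starf f @` starset A ;
  starset_diag : forall T : Type,
    starset [set z : T * T | z.1 = z.2]
      = [set z | starf fst z = starf snd z] }.

Arguments emb {_ T}.
Arguments starf {_ S T}.
Arguments starset {_ T}.
Arguments starpair {_ S T}.

(* V_0 = R and V_{k+1} is the (disjoint) union of V_k and its power set. *)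
Fixpoint superstructure (T : Type) (k : nat) : Type :=
  if k is k'.+1 then (superstructure T k' + set (superstructure T k'))%type
  else T.

(* Only families of subsets of the sets of the superstructure over the reals
   are considered: no extension can satisfy this for all types of a universe
   that contains its own nonstandard sets. *)
Definition enlargement (R : realType) (E : nonstandard_extension) : Prop :=
  forall (k : nat) (F : set (set (superstructure R k))),
    finI F id -> exists x : E (superstructure R k), forall A, F A -> starset A x.

Definition starrel (E : nonstandard_extension) (S T : Type)
    (P : S -> T -> Prop) (x : E S) (y : E T) : Prop :=
  starset [set z : S * T | P z.1 z.2] (starpair x y).

Definition positive_infinitesimal (R : realType) (E : nonstandard_extension)
    (d : E R) : Prop :=
  starrel (fun a b : R => a < b) (emb 0) d /\
  forall e : R, 0 < e -> starrel (fun a b : R => a < b) d (emb e).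

(* The library norm on 'rV[R]_n is the max norm. *)
Definition enorm (R : realType) (n : nat) (x : 'rV[R]_n) : R :=
  Num.sqrt (\sum_(i < n) x ord0 i ^+ 2).

(* Maps are total: the values away from 0 of a map that is only defined near 0
   do not affect its germ. *)
Definition map0 (R : realType) (n p : nat) : Type :=
  {f : 'rV[R]_n -> 'rV[R]_p | f 0 == 0}.

Definition germ_rel (R : realType) (n p : nat) (f g : map0 R n p) : bool :=
  `[< \forall x \near (0 : 'rV[R]_n), sval f x = sval g x >].

Lemma germ_rel_equiv (R : realType) (n p : nat) :
  equiv_class_of (@germ_rel R n p).
Proof.
split=> [f | f g | g f h].
- by apply/asboolP; near=> x.
- by apply/asboolP/asboolP; apply: filterS => x ->.
- move=> /asboolP fg /asboolP gh; apply/asboolP.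
  by near=> x; transitivity (sval g x); near: x.
Unshelve. all: by end_near. Qed.

Canonical germ_equiv (R : realType) (n p : nat) :=
  EquivRelPack (@germ_rel_equiv R n p).

(* G_{n,p}; the germ of f is written \pi f. *)
Definition germ (R : realType) (n p : nat) : Type :=
  {eq_quot (@germ_equiv R n p)}.

Lemma germ_eqP (R : realType) (n p : nat) (f g : map0 R n p) :
  \pi_(germ R n p) f = \pi_(germ R n p) g <->
  \forall x \near (0 : 'rV[R]_n), sval f x = sval g x.
Proof.
split=> [/eqP|fg]; first by rewrite eqmodE => /asboolP.
by apply/eqP; rewrite eqmodE; apply/asboolP.
Qed.

Lemma map0_add_subproof (R : realType) (n p : nat) (f g : map0 R n p) :
  sval f 0 + sval g 0 == 0.
Proof. by rewrite (eqP (svalP f)) (eqP (svalP g)) addr0. Qed.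

Definition map0_add (R : realType) (n p : nat) (f g : map0 R n p) :
    map0 R n p :=
  exist _ (fun x => sval f x + sval g x) (map0_add_subproof f g).

Lemma map0_comp_subproof (R : realType) (n p q : nat) (h : map0 R p q)
  (f : map0 R n p) : sval h (sval f 0) == 0.
Proof. by rewrite (eqP (svalP f)) (eqP (svalP h)). Qed.

Definition map0_comp (R : realType) (n p q : nat) (h : map0 R p q)
    (f : map0 R n p) : map0 R n q :=
  exist _ (fun x => sval h (sval f x)) (map0_comp_subproof h f).

Lemma map0_coord_subproof (R : realType) (n p : nat) (i : 'I_p)
  (f : map0 R n p) : const_mx (sval f 0 ord0 i) == 0 :> 'rV[R]_1.
Proof. by rewrite (eqP (svalP f)) mxE. Qed.

Definition map0_coord (R : realType) (n p : nat) (i : 'I_p) (f : map0 R n p) :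
    map0 R n 1 :=
  exist _ (fun x => const_mx (sval f x ord0 i)) (map0_coord_subproof i f).

Definition germ_add (R : realType) (n p : nat) (f g : germ R n p) :
    germ R n p :=
  \pi_(germ R n p) (map0_add (repr f) (repr g)).

Definition germ_coord (R : realType) (n p : nat) (i : 'I_p) (f : germ R n p) :
    germ R n 1 :=
  \pi_(germ R n 1) (map0_coord i (repr f)).

Definition germ_continuous (R : realType) (n p : nat) (g : germ R n p) : bool :=
  `[< exists f : map0 R n p, \pi_(germ R n p) f = g /\
        \forall x \near (0 : 'rV[R]_n), {for x, continuous (sval f)} >].

(* G^0_{n,p} *)
Definition germ0 (R : realType) (n p : nat) : Type :=
  {g : germ R n p | germ_continuous g}.

Lemma repr_germ (R : realType) (n p : nat) (f : map0 R n p) :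
  \forall x \near (0 : 'rV[R]_n), sval (repr (\pi_(germ R n p) f)) x = sval f x.
Proof. by apply/germ_eqP; rewrite reprK. Qed.

Lemma germ_addE (R : realType) (n p : nat) (f g : map0 R n p) :
  germ_add (\pi_(germ R n p) f) (\pi_(germ R n p) g)
    = \pi_(germ R n p) (map0_add f g).
Proof.
apply/germ_eqP; have := repr_germ g; have := repr_germ f.
by apply: filterS2 => x /= -> ->.
Qed.

Lemma germ_coordE (R : realType) (n p : nat) (i : 'I_p) (f : map0 R n p) :
  germ_coord i (\pi_(germ R n p) f) = \pi_(germ R n 1) (map0_coord i f).
Proof.
by apply/germ_eqP; have := repr_germ f; apply: filterS => x /= ->.
Qed.

Lemma germ_continuousP (R : realType) (n p : nat) (f : map0 R n p) :
  germ_continuous (\pi_(germ R n p) f) <->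
  \forall x \near (0 : 'rV[R]_n), {for x, continuous (sval f)}.
Proof.
split=> [/asboolP[g [/germ_eqP gf gc]]|fc]; last by apply/asboolP; exists f.
near=> x; rewrite /prop_for /continuous_at.
have gfx : \forall y \near x, sval g y = sval f y.
  by near: x; exact: (near_join gf).
have gcx : sval g @ x --> sval g x by near: x.
rewrite -(nbhs_singleton gfx); apply: cvg_trans gcx.
exact: (@near_eq_cvg _ _ _ (nbhs_filter x) _ _ gfx).
Unshelve. all: by end_near. Qed.

Lemma germ_comp_continuous (R : realType) (n p q : nat) (h : germ0 R p q)
    (f : germ0 R n p) :
  germ_continuous
    (\pi_(germ R n q) (map0_comp (repr (sval h)) (repr (sval f)))).
Proof.
apply/germ_continuousP.
have /germ_continuousP hc : germ_continuous (\pi_(germ R p q) (repr (sval h))).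
  by rewrite reprK; exact: (svalP h).
have /germ_continuousP fc : germ_continuous (\pi_(germ R n p) (repr (sval f))).
  by rewrite reprK; exact: (svalP f).
have f0 : sval (repr (sval f)) 0 = 0 by apply/eqP/(svalP (repr (sval f))).
have /= fc0 := nbhs_singleton fc.
move: hc; rewrite -{1}f0 => /fc0 hfc.
near=> x; apply: continuous_comp; first by near: x.
by near: x.
Unshelve. all: by end_near. Qed.

(* [f] |-> [h o f] *)
Definition lc (R : realType) (n p q : nat) (h : germ0 R p q)
    (f : germ0 R n p) : germ0 R n q :=
  exist (fun g => germ_continuous g) _ (germ_comp_continuous h f).

Lemma lcE (R : realType) (n p q : nat) (h : germ0 R p q) (f : germ0 R n p)
    (h' : map0 R p q) (f' : map0 R n p) :
  sval h = \pi_(germ R p q) h' -> sval f = \pi_(germ R n p) f' ->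
  sval (lc h f) = \pi_(germ R n q) (map0_comp h' f').
Proof.
case: f => f fP /= hE fE; apply/germ_eqP; rewrite /= hE fE.
have /germ_continuousP fc : germ_continuous (\pi_(germ R n p) f').
  by rewrite -fE.
have /= fc0 := nbhs_singleton fc.
have := repr_germ h'.
have f0 : sval f' 0 = 0 by apply/eqP/(svalP f').
rewrite -{1}f0 => /fc0 hh; near=> x.
have -> : sval (repr (\pi_(germ R n p) f')) x = sval f' x.
  by near: x; exact: repr_germ.
by near: x.
Unshelve. all: by end_near. Qed.

(* ||f||_r; it is +oo when f is unbounded on the ball. *)
Definition supnorm (R : realType) (n : nat) (f : map0 R n 1) (r : R) : \bar R :=
  ereal_sup [set (enorm (sval f x))%:E | x in [set x | enorm x <= r]].

(* Representatives of the germs of M; the values at t <= 0 are irrelevant, as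
   they are only evaluated at a positive infinitesimal. *)
Definition moduli (R : realType) : set (R -> R) :=
  [set m : R -> R | [/\ forall t, 0 < t -> 0 < m t,
    m t @[t --> (0 : R)^'+] --> (0 : R) &
    exists2 c, 0 < c &
      forall r t : R, 0 < r -> r < t -> t < c -> m r < m t]].

Definition Nd (R : realType) (E : nonstandard_extension) (d : E R) :
    set (E R) :=
  [set starf m d | m in @moduli R].

Definition Ud (R : realType) (E : nonstandard_extension) (d : E R) (n : nat)
    (r : E R) : set (germ R n 1) :=
  [set \pi_(germ R n 1) f | f in [set f : map0 R n 1 |
    starrel (fun (a : \bar R) (b : R) => (a < b%:E)%E)
      (starf (supnorm f) d) r]].

Definition tau_subbase (R : realType) (E : nonstandard_extension) (d : E R)
    (n : nat) : set (set (germ R n 1)) :=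
  [set V | exists2 r, Nd d r &
    exists f, V = [set germ_add u f | u in Ud d r]].

(* G_{n,1} with the topology tau^d. *)
Definition tgerm1 (R : realType) (E : nonstandard_extension) (d : E R)
  (n : nat) : Type := germ R n 1.
HB.instance Definition _ (R : realType) (E : nonstandard_extension) (d : E R)
  (n : nat) := Choice.on (tgerm1 d n).
HB.instance Definition _ (R : realType) (E : nonstandard_extension) (d : E R)
  (n : nat) := isSubBaseTopological.Build (tgerm1 d n)
    (@tau_subbase R E d n) (fun V : set (germ R n 1) => V).

Definition germ_coords (R : realType) (E : nonstandard_extension) (d : E R)
    (n p : nat) (f : germ R n p) : prod_topology (fun _ : 'I_p => tgerm1 d n) :=
  fun i => germ_coord i f.

(* G_{n,p} with the product topology. *)
Definition tgerm (R : realType) (E : nonstandard_extension) (d : E R)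
  (n p : nat) : Type := initial_topology (@germ_coords R E d n p).
HB.instance Definition _ (R : realType) (E : nonstandard_extension) (d : E R)
  (n p : nat) := Topological.on (tgerm d n p).

(* G^0_{n,p} with the subspace topology. *)
Definition tgerm0 (R : realType) (E : nonstandard_extension) (d : E R)
  (n p : nat) : Type :=
  initial_topology (sval : germ0 R n p -> tgerm d n p).
HB.instance Definition _ (R : realType) (E : nonstandard_extension) (d : E R)
  (n p : nat) := Topological.on (tgerm0 d n p).

(* Main.v *)
Require Import Defs.
From mathcomp Require Import all_boot all_order all_algebra.
From mathcomp Require Import all_classical all_reals all_analysis.
From mathcomp Require Import generic_quotient lra.

Set Implicit Arguments.
Unset Strict Implicit.
Unset Printing Implicit Defensive.

Import Order.TTheory GRing.Theory Num.Theory.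
Import numFieldNormedType.Exports.

Local Open Scope classical_set_scope.
Local Open Scope ring_scope.
Local Open Scope quotient_scope.

(** A subbasic neighbourhood of a germ k in tau^d is a ball
    {a : *||a - g||_d < *m(d)} containing k, whose centre g may be far from k.
    Its margin *m(d) - *||k - g||_d may be smaller than every element of N_d:
    this happens for d = 1/N + e with N infinite and e < *u(1/N) for all real
    functions u > 0, if m(t) - ||k - g||_t = (t - 1/n) / 2 just above 1/n.  So
    a ball around k need not be contained in the given one, and applying a
    modulus of continuity of h to radii of balls centred at k cannot suffice.

    The remedy is to rescale the two monotone functions m(t) and
    F(t) = ||h o f0 - g||_t rather than their difference.  Given a positive
    nondecreasing function theta, there is a nondecreasing function Theta with
    jumps at rational points, so small that
      0 < Theta(m(t)) - Theta(F(s)) <= theta(m(t) - F(s))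
    whenever 0 < s <= t are small and F(t) < m(t), and such that Theta o m is
    again a modulus.  This is [rescale_gap].  The size of the jump at q is
    dictated by a positive lower bound of m(u) - F(s) over the pairs s <= u
    with F(u) < m(u) and F(s) <= q < m(u).  Monotonicity alone gives such a
    bound as soon as F(t) < q < m(t) for some t: either u >= t, and
    m(u) - F(s) >= m(t) - q, or s <= u < t, and m(u) - F(s) >= q - F(t).

    Let theta(u) be such that h moves points of a compact neighbourhood of 0 by
    at most u/2 under displacements smaller than theta(u)
    ([uniform_modulus]), and let G = Theta o F, m' = Theta o m.  If both balls
    of radius *m'(d) centred at the germs of f0_j + G(|x|) and f0_j - G(|x|)
    contain f_j, then at t = d
      |f_j(x) - f0_j(x)| < m'(t) - G(|x|) <= theta(m(t) - F(|x|))
    for 0 < |x| <= t.  The centres of balls are arbitrary germs, so it does not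
    matter that G jumps.  Hence |h(f(x)) - h(f0(x))| is at most half of
    m(t) - F(|x|), and h o f stays in the ball that contains h o f0
    ([composition_estimate]).

    On the nonstandard side, the sets A of reals with d in *A form a proper
    filter containing every interval ]0, c[, and *u(d) < *v(d) means that
    u < v holds on a set of this filter ([starrelE]); all else is real
    analysis. *)

(** * Nondecreasing functions with prescribed jumps at the rational points *)

Definition dense_seq (R : realType) (j : nat) : R :=
  ratr (odflt 0 (unpickle j)).

Lemma dense_seqP (R : realType) (a b : R) : a < b ->
  exists j, a < dense_seq R j < b.
Proof.
move=> /rat_in_itvoo[q]; rewrite in_itv /= => qab.
by exists (pickle q); rewrite /dense_seq pickleK.
Qed.

(** The weights 1/2, 1/4, ... have sum 1: a bound for the terms is a bound for
    the sum, so that jumps can be estimated one at a time. *)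
Definition binary_sum (R : realType) (b : nat -> R) : R :=
  limn (series (fun k => b k / (2 ^ (k + 1))%:R)).

Section BinarySum.
Variable R : realType.
Implicit Types (b : nat -> R) (B : R).

Lemma binary_sum_cvg b B : (forall k, 0 <= b k <= B) ->
  cvgn (series (fun k => b k / (2 ^ (k + 1))%:R)).
Proof.
move=> bB; apply: (@series_le_cvg _ _ (fun k => B / (2 ^ (k + 1))%:R)).
- by move=> k; rewrite divr_ge0//; have /andP[] := bB k.
- move=> k; rewrite divr_ge0//; have /andP[b0 b1] := bB k.
  exact: le_trans b1.
- by move=> k; rewrite ler_wpM2r//; have /andP[] := bB k.
- exact: (cvgP _ (cvg_geometric_series_half B 0)).
Qed.

Lemma binary_sum_le b B : (forall k, 0 <= b k <= B) -> binary_sum b <= B.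
Proof.
move=> bB.
have hB : series (fun k => B / (2 ^ (k + 1))%:R) @ \oo --> B.
  by have := cvg_geometric_series_half B 0; rewrite expr0 divr1.
rewrite -[leRHS](cvg_lim _ hB)//; apply: lim_series_le.
- exact: binary_sum_cvg bB.
- exact: cvgP hB.
- by move=> k; rewrite ler_wpM2r//; have /andP[] := bB k.
Qed.

Lemma binary_sum_ge b B j : (forall k, 0 <= b k <= B) ->
  b j / (2 ^ (j + 1))%:R <= binary_sum b.
Proof.
move=> bB.
have b0 k : 0 <= b k / (2 ^ (k + 1))%:R.
  by rewrite divr_ge0//; have /andP[] := bB k.
apply: le_trans (nondecreasing_cvgn_le _ (binary_sum_cvg bB) j.+1).
  rewrite /series /= big_nat_recr//= lerDr.
  by rewrite sumr_ge0.
by apply: nondecreasing_series => k _ _; exact: b0.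
Qed.

Lemma binary_sum_ge0 b B : (forall k, 0 <= b k <= B) -> 0 <= binary_sum b.
Proof.
move=> bB; apply: le_trans (binary_sum_ge 0 bB).
by rewrite divr_ge0//; have /andP[] := bB 0%N.
Qed.

Lemma binary_sumB b b' B : (forall k, 0 <= b k <= B) ->
  (forall k, 0 <= b' k <= B) ->
  binary_sum b - binary_sum b' = binary_sum (fun k => b k - b' k).
Proof.
move=> bB b'B; rewrite /binary_sum -lim_seriesB.
- by congr (limn (series _)); apply/funext => k; rewrite /= mulrBl.
- exact: binary_sum_cvg bB.
- exact: binary_sum_cvg b'B.
Qed.

End BinarySum.

(** Nondecreasing in v, with a jump proportional to [a j] at the j-th rational
    point. *)
Definition jump_fun (R : realType) (a : nat -> R) (v : R) : R :=
  binary_sum (fun j => if dense_seq R j < v then a j else 0).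

Section JumpFun.
Variables (R : realType) (a : nat -> R).
Hypothesis a_ge0 : forall j, 0 <= a j.
Hypothesis a_le : forall j, a j <= Num.max 0 (dense_seq R j).

(* Since a j is at most the j-th rational point, the jumps before v are at most
   v, and there are none before 0. *)
Let mask_le v j :
  0 <= (if dense_seq R j < v then a j else 0) <= Num.max 0 v.
Proof.
case: ifPn => [jv|_]; last by rewrite lexx le_max lexx.
rewrite a_ge0 (le_trans (a_le j))// ge_max !le_max lexx /=.
by rewrite (ltW jv) orbT.
Qed.

Lemma jump_fun_ge0 v : 0 <= jump_fun a v.
Proof. exact: binary_sum_ge0 (mask_le v). Qed.

Lemma jump_fun_le v : 0 <= v -> jump_fun a v <= v.
Proof.
move=> v0; apply: binary_sum_le => j; have := mask_le v j.
by rewrite max_r.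
Qed.

Let jump_funB u v : u <= v -> jump_fun a v - jump_fun a u =
  binary_sum (fun j => if u <= dense_seq R j < v then a j else 0).
Proof.
move=> uv; rewrite /jump_fun (@binary_sumB _ _ _ (Num.max 0 v)).
- congr binary_sum; apply/funext => j.
  have [ju|uj] /= := ltP (dense_seq R j) u.
    by rewrite (lt_le_trans ju uv) subrr.
  by rewrite subr0.
- exact: mask_le.
- move=> j; have /andP[-> h] := mask_le u j.
  by rewrite (le_trans h)// ge_max !le_max lexx uv orbT.
Qed.

Lemma jump_fun_increment u v B : u <= v -> 0 <= B ->
  (forall j, u <= dense_seq R j < v -> a j <= B) ->
  jump_fun a v - jump_fun a u <= B.
Proof.
move=> uv B0 aB; rewrite jump_funB//; apply: binary_sum_le => j.
by case: ifPn => [/aB ->|_]; rewrite ?a_ge0 ?lexx.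
Qed.

Lemma jump_fun_lt u v j : u <= dense_seq R j < v -> 0 < a j ->
  jump_fun a u < jump_fun a v.
Proof.
move=> /[dup] ujv /andP[uj jv] aj; rewrite -subr_gt0 jump_funB; last first.
  exact: le_trans (ltW jv).
have h : forall k, 0 <= (if u <= dense_seq R k < v then a k else 0) <=
    Num.max 0 v.
  move=> k; have := mask_le v k.
  by case: (u <= _); case: (_ < v) => //= _; rewrite ?lexx le_max lexx.
apply: lt_le_trans (binary_sum_ge j h).
by rewrite ujv divr_gt0// ltr0n expn_gt0.
Qed.

Lemma jump_fun_nd u v : u <= v -> jump_fun a u <= jump_fun a v.
Proof.
move=> uv; rewrite -subr_ge0 jump_funB//.
apply: (@binary_sum_ge0 _ _ (Num.max 0 v)) => k; have := mask_le v k.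
by case: (u <= _); case: (_ < v) => //= _; rewrite ?lexx le_max lexx.
Qed.

End JumpFun.

(** Near 0, m' and F' are the composites of m and F with the same function
    [jump_fun a], the Theta of the introductory comment.  Strict monotonicity
    of m' also has to be ensured at the points where m <= F, as it is part of
    being a modulus. *)
Lemma rescale_gap (R : realType) (m F theta : R -> R) (c : R) :
  moduli m -> 0 < c ->
  (forall s, 0 < s -> 0 <= F s) ->
  (forall s t, 0 < s -> s <= t -> t < c -> F s <= F t) ->
  (forall u, 0 < u -> 0 < theta u) ->
  (forall u v, 0 < u -> u <= v -> theta u <= theta v) ->
  exists m' F' : R -> R, [/\ moduli m', forall s, 0 <= F' s &
    exists2 c', 0 < c' & forall s t, 0 < s -> s <= t -> t < c' ->
      F' s <= F' t /\
      (F t < m t -> F' s < m' t <= F' s + theta (m t - F s))].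
Proof.
move=> [m0 mlim [cm cm0 mincr]] c0 F0 Fnd th0 thnd.
pose c' := Num.min c cm.
have c'0 : 0 < c' by rewrite lt_min c0.
have tc t : t < c' -> t < c by rewrite lt_min => /andP[].
have tcm t : t < c' -> t < cm by rewrite lt_min => /andP[].
pose rel q s t := [/\ 0 < s, s <= t, t < c', F t < m t & F s <= q < m t].
pose ok q := 0 < q /\
  exists2 e, 0 < e & forall s t, rel q s t -> e <= m t - F s.
have relgt0 q s t : rel q s t -> 0 < m t - F s.
  by move=> [s0 st /tc ct Fm _]; rewrite subr_gt0 (le_lt_trans _ Fm)// Fnd.
have /choice[a aP] : forall j, exists a : R,
    [/\ 0 <= a, a <= Num.max 0 (dense_seq R j), ok (dense_seq R j) -> 0 < a &
      forall s t, rel (dense_seq R j) s t -> a <= theta (m t - F s)].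
  move=> j; have [[q0 [e e0 He]]|nok] := pselect (ok (dense_seq R j)).
    (* The bound by theta e controls the increments of the jump function, the
       bound by the point itself makes it smaller than the identity. *)
    exists (Num.min (theta e) (dense_seq R j)); split.
    - by rewrite le_min (ltW q0) (ltW (th0 _ e0)).
    - by rewrite le_max !ge_min lexx !orbT.
    - by rewrite lt_min q0 th0.
    - by move=> s t /He h; rewrite ge_min thnd.
  exists 0; split=> //; first by rewrite le_max ?lexx.
  by move=> s t /relgt0 h; exact: ltW (th0 _ h).
have a0 j : 0 <= a j by have [] := aP j.
have al j : a j <= Num.max 0 (dense_seq R j) by have [] := aP j.
have aok j : ok (dense_seq R j) -> 0 < a j by have [] := aP j.
have ath j s t : rel (dense_seq R j) s t -> a j <= theta (m t - F s).
  by have [_ _ _] := aP j; apply.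
have mle r t : 0 < r -> r <= t -> t < c' -> m r <= m t.
  move=> r0; rewrite le_eqVlt => /orP[/eqP -> //|rt] /tcm tc'.
  exact/ltW/mincr.
have ok_gap t q : 0 < t -> t < c' -> F t < q < m t -> ok q.
  move=> t0 tc' /andP[Fq qm]; split; first exact: le_lt_trans (F0 _ t0) Fq.
  exists (Num.min (m t - q) (q - F t)); first by rewrite lt_min !subr_gt0 qm.
  move=> s u [s0 su uc' Fm /andP[Fsq qmu]]; rewrite ge_min.
  have [tu|ut] := leP t u.
    by have h := mle _ _ t0 tu uc'; apply/orP; left; lra.
  have := Fnd _ _ s0 (le_trans su (ltW ut)) (tc _ tc') => h.
  by apply/orP; right; lra.
have Mincr r t : 0 < r -> r < t -> t < c' ->
    jump_fun a (m r) < jump_fun a (m t).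
  move=> r0 rt tc'.
  (* If F < m at some u of ]r, t], a point of ]F u, m u[ beyond m r carries a
     jump. *)
  have [[u [ru ut Fmu]]|nD] :=
      pselect (exists u, [/\ r < u, u <= t & F u < m u]).
    have u0 := lt_trans r0 ru; have uc' := le_lt_trans ut tc'.
    have mru : m r < m u by apply: mincr => //; exact: tcm.
    have [j /andP[]] : exists j, Num.max (F u) (m r) < dense_seq R j < m u.
      by apply: dense_seqP; rewrite gt_max Fmu.
    rewrite gt_max => /andP[Fj rj] ju.
    apply: (@jump_fun_lt _ _ a0 al _ _ j).
      by rewrite (ltW rj) (lt_le_trans ju)// mle.
    by apply/aok/(ok_gap u) => //; rewrite Fj.
  (* Here F >= m on ]r, t], so every pair (s, u) around a point q of ]m r, m t[
     has u > t: m t - q is a lower bound for the gaps at q. *)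
  have mrt : m r < m t by apply: mincr => //; exact: tcm.
  have [j /andP[rj jt]] := dense_seqP mrt.
  apply: (@jump_fun_lt _ _ a0 al _ _ j); first by rewrite (ltW rj).
  apply: aok; split; first exact: lt_trans (m0 _ r0) rj.
  exists (m t - dense_seq R j); first by rewrite subr_gt0.
  move=> s u [s0 su uc' Fmu /andP[Fj ju]].
  have [ut|tu] := leP u t; last first.
    by have := mle _ _ (lt_trans r0 rt) (ltW tu) uc'; lra.
  exfalso; apply: nD; exists u; split=> //.
  rewrite ltNge; apply/negP => ur.
  have := mle _ _ (lt_le_trans s0 su) ur (lt_trans rt tc').
  lra.
exists (fun t => if t < c' then jump_fun a (m t) else 1), (jump_fun a \o F).
split.
- split.
  + move=> t t0; case: ifPn => // tc'.
    have t20 : 0 < t / 2 by rewrite divr_gt0.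
    apply: le_lt_trans (Mincr _ _ t20 _ tc'); first exact: jump_fun_ge0.
    by rewrite ltr_pdivrMr// ltr_pMr// ltr1n.
  + apply: (@squeeze_cvgr _ _ _ _ (cst 0) m) => //; last exact: cvg_cst.
    near=> t.
    have tc' : t < c' by near: t; exact: nbhs_right_lt.
    have t0 : 0 < t by near: t; exact: nbhs_right_gt.
    by rewrite tc' jump_fun_ge0//= jump_fun_le// ltW// m0.
  + by exists c' => // r t r0 rt tc'; rewrite tc' (lt_trans rt tc') Mincr.
- by move=> s; exact: jump_fun_ge0.
- exists c' => // s t s0 st tc'.
  have Fst : F s <= F t by rewrite Fnd// tc.
  split=> [|Fm]; first exact: jump_fun_nd.
  rewrite tc' /=.
  have [j /andP[Fj jm]] := dense_seqP Fm.
  apply/andP; split.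
    apply: le_lt_trans (_ : jump_fun a (F t) < _); first exact: jump_fun_nd.
    apply: (@jump_fun_lt _ _ a0 al _ _ j); first by rewrite (ltW Fj).
    by apply/aok/(ok_gap t); rewrite ?Fj//; exact: lt_le_trans st.
  rewrite -lerBlDl; apply: jump_fun_increment => //.
  + exact: le_trans Fst (ltW Fm).
  + by apply/ltW/th0; rewrite subr_gt0; exact: le_lt_trans Fm.
  + by move=> k kP; apply: ath; split.
Unshelve. all: by end_near. Qed.

(** * Uniform continuity near a point *)

(** Only y is confined to the compact set, y' is arbitrary; this is why h has to
    be continuous, at the points of K, as a map on the whole space. *)
Lemma compact_continuous_unif (R : realType) (V W : normedModType R)
    (h : V -> W) (K : set V) : compact K ->
  (forall y, K y -> {for y, continuous h}) ->
  forall e : R, 0 < e -> exists2 r : R, 0 < r &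
    forall y y', K y -> `|y' - y| < r -> `|h y' - h y| <= e.
Proof.
move=> /compact_near_coveringP Kc hc e e0.
have e20 : 0 < e / 2 by rewrite divr_gt0.
have H : \forall r \near (0 : R)^'+, K `<=`
    [set y | forall y', `|y' - y| < r -> `|h y' - h y| <= e].
  apply: Kc => x /hc hx.
  have /nbhs_ballP[r /= r0 Hr] : \forall z \near x, `|h x - h z| < e / 2.
    by move: hx => /cvgr_dist_lt; apply.
  have r20 : 0 < r / 2 by rewrite divr_gt0.
  exists (ball x (r / 2), [set s : R | s < r / 2]).
    by split; [exact: nbhsx_ballx|exact: nbhs_right_lt].
  move=> [x' s] [/= xx' sr] y' y's; rewrite -ball_normE /= in xx'.
  have := Hr y'; have := Hr x'; rewrite -!ball_normE /= => Hx' Hy'.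
  have {}Hx' : `|h x - h x'| < e / 2 by apply: Hx'; lra.
  have {}Hy' : `|h x - h y'| < e / 2.
    apply: Hy'; rewrite -(subrKA x') (le_lt_trans (ler_normD _ _))//.
    by rewrite (distrC x' y'); lra.
  rewrite -(subrKA (h x)) (le_trans (ler_normD _ _))// (distrC (h y')).
  by lra.
have [r [r0 Hr]] := filter_ex (filterI (nbhs_right_gt (0 : R)) H).
by exists r => // y y' Ky; exact: Hr.
Qed.

(** Taking theta u to be the supremum of the displacements admissible for u
    makes theta monotone; the bound 1 on displacements makes it finite. *)
Lemma uniform_modulus (R : realType) (p : nat) (W : normedModType R)
    (h : 'rV[R]_p -> W) :
  (\forall y \near (0 : 'rV[R]_p), {for y, continuous h}) ->
  exists2 rho : R, 0 < rho & exists theta : R -> R,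
    [/\ forall u, 0 < u -> 0 < theta u,
      forall u v, 0 < u -> u <= v -> theta u <= theta v &
      forall u y y', 0 < u -> `|y| <= rho -> `|y' - y| < theta u ->
        `|h y' - h y| <= u].
Proof.
move=> /nbhs_ballP[r /= r0 hr]; pose rho := r / 2.
have rho0 : 0 < rho by rewrite divr_gt0.
exists rho => //.
pose K := [set y : 'rV[R]_p | `|y| <= rho].
have Kc : compact K.
  apply: bounded_closed_compact.
    exists rho; split; first exact: num_real.
    by move=> M rM y /= /le_trans; apply; exact: ltW.
  rewrite /K; have -> : [set y : 'rV[R]_p | `|y| <= rho] =
    (fun y : 'rV[R]_p => `|y|) @^-1` [set x | x <= rho] by [].
  apply: closed_comp; last exact: closed_le.
  by move=> y _; exact: norm_continuous.
have hK y : K y -> {for y, continuous h}.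
  move=> Ky; apply: hr; rewrite -ball_normE /= sub0r normrN.
  by apply: le_lt_trans Ky _; rewrite /rho ltr_pdivrMr// ltr_pMr// ltr1n.
have unif := compact_continuous_unif Kc hK.
pose S u := [set d : R | 0 <= d <= 1 /\
  forall y y', K y -> `|y' - y| < d -> `|h y' - h y| <= u].
have Sub u : has_ubound (S u) by exists 1 => d [/andP[]].
have S0 u : 0 < u -> S u 0.
  move=> u0; split; first by rewrite lexx ler01.
  by move=> y y' _; rewrite ltNge normr_ge0.
exists (fun u => sup (S u)); split.
- move=> u /unif[d d0 hd].
  apply: lt_le_trans (_ : Num.min d 1 <= _); first by rewrite lt_min d0 ltr01.
  apply: ub_le_sup; first exact: Sub.
  split; first by rewrite le_min ltW// ler01 ge_min lexx orbT.
  by move=> y y' Ky; rewrite lt_min => /andP[/hd + _]; apply.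
- move=> u v u0 uv; apply: sup_le; first last.
  + by split; [exists 0; apply/S0/(lt_le_trans u0)|exact: Sub].
  + by exists 0; exact: S0.
  + move=> d [d01 hd]; apply/downP; exists d => //; split=> // y y' Ky yd.
    exact: le_trans (hd _ _ Ky yd) uv.
- move=> u y y' u0 yrho /sup_gt[|d [_ hd] yd]; last exact: hd.
  by exists 0; exact: S0.
Qed.

(** * Norms of vectors and sup norms of maps *)

Lemma coord_le_norm (R : realType) (n : nat) (x : 'rV[R]_n) i :
  `|x ord0 i| <= `|x|.
Proof.
rewrite [leRHS]/Num.norm /= mx_normrE.
exact: (@le_bigmax _ _ _ _ (fun ij : 'I_1 * 'I_n => `|x ij.1 ij.2|) (ord0, i)).
Qed.

Lemma norm_lt_coord (R : realType) (n : nat) (x : 'rV[R]_n) (b : R) :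
  0 < b -> (forall i, `|x ord0 i| < b) -> `|x| < b.
Proof.
move=> b0 xb; rewrite /Num.norm /= mx_normrE.
apply: bigmax_lt => // -[i j] _ /=.
by rewrite (ord1 i).
Qed.

Section Enorm.
Variable R : realType.

Lemma norm_le_enorm n (x : 'rV[R]_n) : `|x| <= enorm x.
Proof.
rewrite {1}/Num.norm /= mx_normrE; apply: bigmax_le; first exact: sqrtr_ge0.
move=> [i j] _ /=; rewrite (ord1 i) -sqrtr_sqr ler_wsqrtr//.
rewrite (bigD1 j)//= lerDl; apply: sumr_ge0 => k _; exact: sqr_ge0.
Qed.

Lemma enorm1 (x : 'rV[R]_1) : enorm x = `|x ord0 ord0|.
Proof. by rewrite /enorm big_ord_recl big_ord0 addr0 sqrtr_sqr. Qed.

Lemma enorm_gt0 n (x : 'rV[R]_n) : x != 0 -> 0 < enorm x.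
Proof.
by move=> x0; apply: lt_le_trans (norm_le_enorm x); rewrite normr_gt0.
Qed.

Lemma near0_enorm n (P : set 'rV[R]_n) :
  (\forall x \near (0 : 'rV[R]_n), P x) ->
  exists2 c : R, 0 < c & forall x, enorm x < c -> P x.
Proof.
move=> /nbhs_ballP[c /= c0 Pc]; exists c => // x xc; apply: Pc.
rewrite -ball_normE /= sub0r normrN.
exact: le_lt_trans (norm_le_enorm x) xc.
Qed.

End Enorm.

Lemma map0_sub_subproof (R : realType) (n p : nat) (f g : map0 R n p) :
  sval f 0 - sval g 0 == 0.
Proof. by rewrite (eqP (svalP f)) (eqP (svalP g)) subr0. Qed.

Definition map0_sub (R : realType) (n p : nat) (f g : map0 R n p) :
    map0 R n p :=
  exist _ (fun x => sval f x - sval g x) (map0_sub_subproof f g).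

Section Supnorm.
Variables (R : realType) (n : nat).
Implicit Types f g : map0 R n 1.

Lemma supnorm_le f (t b : R) :
  (forall x, enorm x <= t -> `|sval f x ord0 ord0| <= b) ->
  (supnorm f t <= b%:E)%E.
Proof.
move=> fb; apply: ge_ereal_sup => _ [x /= xt <-].
by rewrite lee_fin enorm1 fb.
Qed.

Lemma supnorm_ge f (t : R) x : enorm x <= t ->
  (`|sval f x ord0 ord0|%:E <= supnorm f t)%E.
Proof.
by move=> xt; apply: ereal_sup_ubound; exists x => //; rewrite enorm1.
Qed.

Lemma supnorm_ge0 f (t : R) : 0 <= t -> (0 <= supnorm f t)%E.
Proof.
move=> t0; apply: le_trans (supnorm_ge f (x := 0) _); first by rewrite lee_fin.
by rewrite /enorm big1 ?sqrtr0// => i _; rewrite mxE expr0n.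
Qed.

Lemma supnorm_nd f (s t : R) : s <= t -> (supnorm f s <= supnorm f t)%E.
Proof.
move=> st; apply: ereal_sup_le => _ [x /= xs <-].
by exists x => //=; exact: le_trans st.
Qed.

Lemma eq_supnorm f g (t : R) :
  (forall x, enorm x <= t -> sval f x = sval g x) -> supnorm f t = supnorm g t.
Proof.
move=> fg; congr ereal_sup; apply/seteqP; split=> _ [x /= xt <-];
  by exists x => //=; rewrite fg.
Qed.

End Supnorm.

(** * The filter of sets whose extension contains d *)

Section Star.
Variable E : nonstandard_extension.

Lemma starset_sub T (A B : set T) : A `<=` B -> @starset E T A `<=` starset B.
Proof. by move=> AB; rewrite -(setIidl AB) starsetI => x []. Qed.

Lemma starset0 T : @starset E T set0 = set0.
Proof. by rewrite -{1}(setICr setT) starsetI starsetC setICr. Qed.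

Lemma starsetT T : @starset E T setT = setT.
Proof. by rewrite -{1}setC0 starsetC starset0 setC0. Qed.

Lemma starset_filter T (x : E T) : Filter [set A : set T | starset A x].
Proof.
split; rewrite /= ?starsetT// => A B; last by move=> /starset_sub; apply.
by move=> /= Ax Bx; rewrite starsetI.
Qed.

(** [unit] has only one nonstandard element because its diagonal is the whole
    square; this makes extensions of constant functions constant. *)
Lemma star_unit (x y : E unit) : x = y.
Proof.
have := starset_diag E unit.
have -> : [set z : unit * unit | z.1 = z.2] = setT.
  by apply/seteqP; split=> // -[[] []].
rewrite starsetT => /seteqP[/(_ (starpair x y) I) /= + _].
by rewrite starpair_fst starpair_snd.
Qed.

Lemma starf_cst S T (b : T) (x : E S) : starf (fun=> b) x = emb b.
Proof.
rewrite (starf_comp (fun _ : unit => b) (fun _ : S => tt) x).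
by rewrite (star_unit (starf _ x) (emb tt)) starf_emb.
Qed.

Lemma starpair_starf S T U (f : S -> T) (g : S -> U) (x : E S) :
  starpair (starf f x) (starf g x) = starf (fun s => (f s, g s)) x.
Proof.
rewrite -[RHS]starpair_eta; congr starpair.
- by rewrite -starf_comp.
- by rewrite -starf_comp.
Qed.

(** Extension commutes with pairing and with inverse images, so the pair of
    values at x is the value at x of a single standard function. *)
Lemma starrelE S T U (P : T -> U -> Prop) (f : S -> T) (g : S -> U) (x : E S) :
  starrel P (starf f x) (starf g x) <-> starset [set s | P (f s) (g s)] x.
Proof.
rewrite /starrel starpair_starf.
by rewrite -[_ (starf _ x)]/((starf (fun s => (f s, g s)) @^-1`
  starset [set z | P z.1 z.2]) x) -starset_preimage.
Qed.

Variables (R : realType) (d : E R).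
Hypothesis d_inf : positive_infinitesimal d.

Lemma starset_small (c : R) : 0 < c -> starset [set t | 0 < t < c] d.
Proof.
move=> c0; case: d_inf => d0 /(_ _ c0) dc.
move: d0; rewrite -(starf_cst 0 d) -[X in starrel _ _ X]starf_id.
move=> /starrelE d0.
move: dc; rewrite -(starf_cst c d) -[X in starrel _ X _]starf_id.
move=> /starrelE dc.
by apply: (@starset_sub _ ([set t : R | 0 < t] `&` [set t | t < c]));
  [move=> t /= [-> ->]|rewrite starsetI].
Qed.

Lemma starset_near (c : R) (A B : set R) : 0 < c ->
  (forall t, 0 < t < c -> A t -> B t) -> starset A d -> starset B d.
Proof.
move=> /starset_small c0 AB Ad.
exact: (@filterS2 _ _ (starset_filter d) _ _ _ AB).
Qed.

Lemma starset_near_ex (c : R) (A : set R) : 0 < c -> starset A d ->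
  exists2 t, 0 < t < c & A t.
Proof.
move=> c0 Ad; apply: contrapT => nA.
have : starset (@set0 R) d.
  by apply: (starset_near c0 _ Ad) => t tc At; apply: nA; exists t.
by rewrite starset0.
Qed.

(** The member U^d_r + [g] of the subbase of tau^d, for r = *m(d). *)
Definition germ_ball (n : nat) (m : R -> R) (g : map0 R n 1) :
    set (germ R n 1) :=
  [set germ_add u (\pi_(germ R n 1) g) | u in Ud d (starf m d)].

(** Representatives can be chosen freely: germs determine supremum norms near 0,
    and d is in the extension of every interval ]0, c[. *)
Lemma germ_ballP n (m : R -> R) (a g : map0 R n 1) :
  germ_ball m g (\pi_(germ R n 1) a) <->
  starset [set t | (supnorm (map0_sub a g) t < (m t)%:E)%E] d.
Proof.
split.
- move=> [_ [u /starrelE ud <-]]; rewrite germ_addE => /germ_eqP H.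
  have [c c0 ug] := near0_enorm H.
  apply: (starset_near c0 _ ud) => t /andP[t0 tc] /= utm.
  rewrite (_ : supnorm _ _ = supnorm u t)//; apply: eq_supnorm => x xt /=.
  by rewrite -ug /= ?addrK// (le_lt_trans xt).
- move=> ad; exists (\pi_(germ R n 1) (map0_sub a g)).
    by exists (map0_sub a g) => //; apply/starrelE.
  rewrite germ_addE; apply/germ_eqP; apply: filterE => x /=.
  by rewrite subrK.
Qed.

End Star.

(** * Continuity into initial, product and subbase topologies *)

Section Topo.

Lemma cvg_initial (S : choiceType) (T : topologicalType) (f : S -> T)
    (F : set_system S) (s : S) : Filter F ->
  f @ F --> f s -> F --> (s : initial_topology f).
Proof.
move=> FF Ff A; rewrite nbhsE => -[_ [[B oB <-] Bs] BA].
apply: (filterS BA); apply: Ff; exact: open_nbhs_nbhs.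
Qed.

Lemma cvg_prod_topology (I : Type) (T : I -> topologicalType)
    (F : set_system (prod_topology T)) (s : prod_topology T) : Filter F ->
  (forall i, (fun f : prod_topology T => f i) @ F --> s i) -> F --> s.
Proof.
move=> FF Fs; apply/cvg_sup => i; apply: cvg_initial; exact: Fs.
Qed.

Lemma continuous_initial (X : topologicalType) (S : choiceType)
    (T : topologicalType) (f : S -> T) (g : X -> S) :
  continuous (f \o g) -> continuous (g : X -> initial_topology f).
Proof. by move=> fg x; apply: cvg_initial; exact: fg. Qed.

Lemma continuous_prod_topology (X : topologicalType) (I : Type)
    (T : I -> topologicalType) (g : X -> prod_topology T) :
  (forall i, continuous (fun x => g x i)) -> continuous g.
Proof. by move=> gc x; apply: cvg_prod_topology => i; exact: gc. Qed.

Variables (R : realType) (E : nonstandard_extension) (d : E R) (n : nat).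

Lemma tau_subbase_nbhs (f : tgerm1 d n) (V : set (germ R n 1)) :
  tau_subbase d V -> V f -> nbhs f V.
Proof.
move=> dV Vf; rewrite (@nbhsE (tgerm1 d n)); exists V => //; split=> //.
exists [set V]; last first.
  by rewrite predeqE => ?; split=> [[_ ->]|] //; exists V.
by move=> _ ->; exact: (finI_from1 id dV).
Qed.

Lemma tau_subbase_cvg (F : set_system (tgerm1 d n)) (f : tgerm1 d n) :
  Filter F -> (forall V, tau_subbase d V -> V f -> F V) -> F --> f.
Proof.
move=> FF FV A; rewrite (@nbhsE (tgerm1 d n)).
move=> [_ [[B sB <-] [C BC Ct] sUBA]].
rewrite nbhs_filterE; apply: filterS sUBA _; apply: (@filterS _ _ _ C).
  by move=> ? ?; exists C.
have /sB [D sD IDeC] := BC; rewrite -IDeC; apply: filter_bigI => V DV.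
have /sD := DV; rewrite inE => sV; apply: FV => //.
by move: Ct; rewrite -IDeC => /(_ _ DV).
Qed.

Lemma continuous_tau (X : topologicalType) (g : X -> tgerm1 d n) :
  (forall V x, tau_subbase d V -> V (g x) -> nbhs x (g @^-1` V)) ->
  continuous g.
Proof. by move=> gV x; apply: tau_subbase_cvg => V dV; exact: gV. Qed.

End Topo.

(** * Left composition *)

Lemma radial_subproof (R : realType) (n : nat) (G : R -> R) :
  (const_mx (if (0 : 'rV[R]_n) == 0 then 0 else G (enorm (0 : 'rV[R]_n)))
    : 'rV[R]_1) == 0.
Proof. by rewrite eqxx; apply/eqP/matrixP => i j; rewrite !mxE. Qed.

(** The value 0 at the origin is imposed so that this is a map (R^n, 0) ->
    (R, 0); G need not tend to 0 there. *)
Definition radial (R : realType) (n : nat) (G : R -> R) : map0 R n 1 :=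
  exist _ (fun x : 'rV[R]_n => const_mx (if x == 0 then 0 else G (enorm x)))
    (radial_subproof n G).

(** The function f0_j + G(|x|) or f0_j - G(|x|), for the pair jb of a coordinate
    j and a sign. *)
Definition offset (R : realType) (n p : nat) (f0 : map0 R n p) (G : R -> R)
    (jb : 'I_p * bool) : map0 R n 1 :=
  map0_add (map0_coord jb.1 f0) (radial n (fun s => (-1) ^+ jb.2 * G s)).

Definition two_sided (R : realType) (n p : nat) (f0 : map0 R n p) (m G : R -> R)
    (t : R) (f : map0 R n p) : Prop :=
  forall jb,
    (supnorm (map0_sub (map0_coord jb.1 f) (offset f0 G jb)) t < (m t)%:E)%E.

(** From |y - G| < m and |y + G| < m follows |y| < m - G: the two balls replace
    a ball with a radius that depends on |x|. *)
Lemma two_sided_lt (R : realType) (n p : nat) (f0 f : map0 R n p) (m G : R -> R)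
    (t : R) (x : 'rV[R]_n) j : two_sided f0 m G t f -> x != 0 -> enorm x <= t ->
  `|sval f x ord0 j - sval f0 x ord0 j| < m t - G (enorm x).
Proof.
move=> ft x0 xt.
have := le_lt_trans (supnorm_ge _ xt) (ft (j, true)).
have := le_lt_trans (supnorm_ge _ xt) (ft (j, false)).
rewrite !lte_fin /= !mxE (negbTE x0) expr0 expr1 !ltr_norml.
move=> /andP[? ?] /andP[? ?].
apply/andP; split; lra.
Qed.

Lemma two_sided_self (R : realType) (n p : nat) (f0 : map0 R n p) (m G : R -> R)
    (t b : R) : 0 <= b -> b < m t ->
  (forall s, 0 < s -> s <= t -> 0 <= G s <= b) -> two_sided f0 m G t f0.
Proof.
move=> b0 bm Gb [j e].
apply: le_lt_trans (_ : b%:E < _)%E; last by rewrite lte_fin.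
apply: supnorm_le => x xt; rewrite /= !mxE opprD addNKr normrN.
case: eqVneq => [_|x0]; first by rewrite normr0.
have /andP[G0 Gxb] := Gb _ (enorm_gt0 x0) xt.
by rewrite normrMsign ger0_norm.
Qed.

(** The real counterpart of the theorem, at a fixed small t in place of d.  The
    point c where the error is finite bounds the range on which the error of f0
    is a real-valued nondecreasing function. *)
Lemma composition_estimate (R : realType) (n p q : nat) (i : 'I_q)
    (h : map0 R p q) (f0 : map0 R n p) (g : map0 R n 1) (m : R -> R) (c : R) :
  let err f := supnorm (map0_sub (map0_coord i (map0_comp h f)) g) in
  (\forall y \near (0 : 'rV[R]_p), {for y, continuous (sval h)}) ->
  {for 0, continuous (sval f0)} ->
  moduli m -> 0 < c -> (err f0 c < (m c)%:E)%E ->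
  exists m' G : R -> R, moduli m' /\
    exists2 c', 0 < c' & forall t, 0 < t < c' -> (err f0 t < (m t)%:E)%E ->
      two_sided f0 m' G t f0 /\
      forall f, two_sided f0 m' G t f -> (err f t < (m t)%:E)%E.
Proof.
move=> err hc f0c mm c0 Ec.
have [rho rho0 [theta [th0 thnd hth]]] := uniform_modulus hc.
have [c2 c20 f0rho] : exists2 c2 : R, 0 < c2 &
    forall x : 'rV[R]_n, enorm x < c2 -> `|sval f0 x| <= rho.
  apply: near0_enorm; move: f0c => /cvgr_dist_lt/(_ _ rho0).
  rewrite (eqP (svalP f0)); apply: filterS => x.
  by rewrite sub0r normrN => /ltW.
pose F s := fine (err f0 s).
have FE s : 0 < s -> s < c -> err f0 s = (F s)%:E.
  move=> s0 sc; rewrite /F fineK// fin_numE; apply/andP; split.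
    by rewrite gt_eqF// (lt_le_trans _ (supnorm_ge0 _ (ltW s0)))// ltNye.
  rewrite lt_eqF// (le_lt_trans (supnorm_nd _ (ltW sc)))//.
  by rewrite (lt_trans Ec)// ltry.
have F0 s : 0 < s -> 0 <= F s.
  by move=> s0; rewrite fine_ge0// supnorm_ge0// ltW.
have Fnd s t : 0 < s -> s <= t -> t < c -> F s <= F t.
  move=> s0 st tc; rewrite -lee_fin -!FE ?(le_lt_trans st)//; last first.
    exact: lt_le_trans st.
  exact: supnorm_nd.
have [||m' [G [m'm G0 [c' c'0 H]]]] :=
    @rescale_gap R m F (fun u => theta (u / 2)) c mm c0 F0 Fnd.
- by move=> u u0; apply: th0; rewrite divr_gt0.
- by move=> u v u0 uv; apply: thnd; [rewrite divr_gt0|rewrite ler_pM2r].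
exists m', G; split=> //; exists (Num.min c' (Num.min c c2)).
  by rewrite !lt_min c'0 c0.
move=> t; rewrite !lt_min => /and4P[t0 tc' tc tc2].
rewrite FE// lte_fin => Fm; split.
  have [_ /(_ Fm)/andP[Gm _]] := H t t t0 (lexx _) tc'.
  apply: (@two_sided_self _ _ _ f0 m' G t (G t)) => // s s0 st.
  by rewrite G0; have [] := H s t s0 st tc'.
move=> f ft.
(* A pointwise bound below m t would not suffice for the supremum; the margin is
   halved so that all values stay below the midpoint of F t and m t. *)
apply: le_lt_trans (_ : ((m t + F t) / 2)%:E < _)%E; last first.
  by rewrite lte_fin; lra.
apply: supnorm_le => x xt.
have [->|x0] := eqVneq x 0.
  rewrite (eqP (svalP (map0_sub _ _))) mxE normr0.
  by have := F0 _ t0; lra.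
have s0 := enorm_gt0 x0; set s := enorm x in s0 xt.
have [_ /(_ Fm)/andP[_ mG]] := H s t s0 xt tc'.
have Fst := Fnd _ _ s0 xt tc.
have mF : 0 < (m t - F s) / 2 by lra.
have fx : `|sval f x - sval f0 x| < theta ((m t - F s) / 2).
  apply: norm_lt_coord => [|j]; first exact: th0.
  rewrite !mxE; apply: lt_le_trans (two_sided_lt j ft x0 xt) _.
  by rewrite -/s lerBlDl.
have hx := hth _ _ _ mF (f0rho x (le_lt_trans xt tc2)) fx.
have {}hx := le_trans (coord_le_norm _ i) hx.
have := supnorm_ge (map0_sub (map0_coord i (map0_comp h f0)) g) (lexx s).
rewrite -/(err f0) FE ?(le_lt_trans xt)// lee_fin.
move: hx; rewrite /= !mxE !ler_norml => /andP[? ?] /andP[? ?].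
apply/andP; split; lra.
Qed.

Lemma germ_coord_continuous (R : realType) (E : nonstandard_extension)
    (d : E R) (n p : nat) (j : 'I_p) :
  continuous ((fun f => germ_coord j (sval f)) : tgerm0 d n p -> tgerm1 d n).
Proof.
move=> f.
apply: (@continuous_comp (tgerm0 d n p) (tgerm d n p) (tgerm1 d n) sval
  (germ_coord j)); first exact: initial_continuous.
apply: (@continuous_comp (tgerm d n p)
  (prod_topology (fun _ : 'I_p => tgerm1 d n)) (tgerm1 d n)
  (@germ_coords R E d n p) (fun g => g j)); first exact: initial_continuous.
exact: proj_continuous.
Qed.

Theorem proposition4p8 (R : realType) (E : nonstandard_extension)
    (E_enl : enlargement R E) (n p : nat) (d : E R)
    (d_inf : positive_infinitesimal d) (h : germ0 R p p) :
  continuous (lc h : tgerm0 d n p -> tgerm0 d n p).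
Proof.
pose rp (f : germ0 R n p) := repr (sval f).
have svalE (f : germ0 R n p) : sval f = \pi_(germ R n p) (rp f).
  by rewrite reprK.
have coordE (f : germ0 R n p) j :
    germ_coord j (sval f) = \pi_(germ R n 1) (map0_coord j (rp f)).
  by rewrite -germ_coordE -svalE.
have /germ_continuousP hc : germ_continuous (\pi_(germ R p p) (repr (sval h))).
  by rewrite reprK; exact: (svalP h).
apply: (@continuous_initial (tgerm0 d n p) _ (tgerm d n p) sval).
apply: (@continuous_initial (tgerm0 d n p) _ _ (@germ_coords R E d n p)).
apply: (@continuous_prod_topology (tgerm0 d n p) 'I_p (fun=> tgerm1 d n)) => i.
apply: continuous_tau => V f0 [_ [m mm <-] [g ->]].
rewrite -(reprK g).
have /germ_continuousP f0c : germ_continuous (\pi_(germ R n p) (rp f0)).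
  by rewrite -svalE; exact: (svalP f0).
have {}f0c := nbhs_singleton f0c.
change (germ_ball d m (repr g) (germ_coord i (sval (lc h f0))) ->
  nbhs f0 [set f : tgerm0 d n p |
    germ_ball d m (repr g) (germ_coord i (sval (lc h f)))]).
rewrite /lc /= germ_coordE => /(germ_ballP d_inf) Ed.
have [c /andP[c0 _] Ec] := starset_near_ex d_inf ltr01 Ed.
have [m' [G [mm' [c' c'0 H]]]] := composition_estimate hc f0c mm c0 Ec.
(* There are finitely many coordinates and signs, so the inequalities for all
   of them hold simultaneously on a set of the filter of d. *)
have two_sided_star (f : germ0 R n p) :
    starset [set t | two_sided (rp f0) m' G t (rp f)] d <->
    forall jb, germ_ball d m' (offset (rp f0) G jb) (germ_coord jb.1 (sval f)).
  split=> [fd jb|fd]; last first.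
    apply: (@filter_forall _ _ _ _ (starset_filter d)) => jb.
    by have := fd jb; rewrite coordE => /(germ_ballP d_inf).
  rewrite coordE; apply/(germ_ballP d_inf).
  by move: fd; apply: starset_sub => t; apply.
have f0_two_sided : starset [set t | two_sided (rp f0) m' G t (rp f0)] d.
  by apply: (starset_near d_inf c'0 _ Ed) => t tc' /(H _ tc')[].
apply: (@filterS _ (nbhs f0) _ [set f : tgerm0 d n p |
    forall jb,
      germ_ball d m' (offset (rp f0) G jb) (germ_coord jb.1 (sval f))]).
  move=> f /two_sided_star f_two_sided.
  rewrite /= germ_coordE; apply/(germ_ballP d_inf).
  apply: (@filterS3 _ _ (starset_filter d) _ _ _ _ _ (starset_small d_inf c'0)
    Ed f_two_sided) => t tc' Et /=.
  by have [_] := H t tc' Et; apply.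
apply: (@filter_forall _ _ _ _ (nbhs_filter f0)) => jb.
apply: (germ_coord_continuous (j := jb.1)); apply: tau_subbase_nbhs.
  by exists (starf m' d); [exists m'|eexists].
exact: (two_sided_star f0).1.
Qed.
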